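(* The infinite ladder graph $P_\infty \square P_2$ satisfies $\textrm{DET:IC\%}(P_\infty \square P_2) = \frac{3}{4}$; that is, the lowest density of a DET:IC on the infinite ladder graph is $\frac34$.
   Context: $P_\infty$ is the two-way infinite path and $\square$ is the Cartesian product of graphs, so the infinite ladder $P_\infty \square P_2$ has vertices $x_i, y_i$ ($i \in \mathbb{Z}$) and edges $x_ix_{i+1}$, $y_iy_{i+1}$, $x_iy_i$ for all $i \in \mathbb{Z}$. For a vertex $v$, $N[v]$ is its closed neighborhood, and for $S \subseteq V(G)$, $N_S[v] = N[v]\cap S$. A set $S \subseteq V(G)$ is an error-detecting identifying code (DET:IC) of $G$ if $|N_S[v]| \ge 2$ for every $v \in V(G)$, and for all distinct $u,v \in V(G)$, $|N_S[u] - N_S[v]| \ge 2$ or $|N_S[v] - N_S[u]| \ge 2$. For a locally finite infinite graph $G$, the density of $S \subseteq V(G)$ is $\limsup_{r\to\infty} \frac{|B_r(v)\cap S|}{|B_r(v)|}$, for any $v \in V(G)$, where $B_r(v) = \{u \in V(G) : d(u,v)\le r\}$. $\textrm{DET:IC\%}(G)$ denotes the lowest density of any DET:IC on $G$. *)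

(* Defs.v *)
From HB Require Import structures.
From mathcomp Require Import all_boot all_order all_algebra.
From mathcomp Require Import finmap.
From mathcomp Require Import all_classical all_reals all_analysis.

Set Implicit Arguments.
Unset Strict Implicit.
Unset Printing Implicit Defensive.

Import Order.TTheory GRing.Theory Num.Theory.

Local Open Scope classical_set_scope.
Local Open Scope ring_scope.

(* A graph on the vertex type V is given by its adjacency relation e : rel V
   (symmetric and irreflexive, locally finite in all the uses below). *)

(* Only meaningful on finite sets: fset_set of an infinite set is fset0. *)
Definition set_card (T : choiceType) (A : set T) : nat := #|` fset_set A|.

Section Graph.
Variables (V : choiceType) (e : rel V).

Definition closed_nbhd (v : V) : set V := [set u | u = v \/ e v u].

Definition nbhd_in (S : set V) (v : V) : set V := closed_nbhd v `&` S.

Definition det_ic (S : set V) : Prop :=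
  (forall v : V, (2 <= set_card (nbhd_in S v))%N) /\
  (forall u v : V, u <> v ->
     (2 <= set_card (nbhd_in S u `\` nbhd_in S v))%N \/
     (2 <= set_card (nbhd_in S v `\` nbhd_in S u))%N).

Definition has_walk (u v : V) (n : nat) : Prop :=
  exists p : seq V, [/\ path e u p, last u p = v & size p = n].

(* d(u, v) = n; no n qualifies when u and v lie in different components. *)
Definition is_dist (u v : V) (n : nat) : Prop :=
  has_walk u v n /\ (forall m : nat, has_walk u v m -> (n <= m)%N).

Definition gball (v : V) (r : nat) : set V :=
  [set u | exists2 n : nat, is_dist u v n & (n <= r)%N].

Definition density (R : realType) (S : set V) (v : V) : \bar R :=
  limn_esup (fun r : nat =>
    ((set_card (gball v r `&` S))%:R / (set_card (gball v r))%:R)%:E).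

(* DET:IC%(G) = d, the lowest density being attained. The base point of the
   density is immaterial: the optimal code has density d, and every code has
   density at least d, with respect to each base point. *)
Definition det_ic_pct (R : realType) (d : \bar R) : Prop :=
  (exists2 S : set V, det_ic S & forall v : V, density R S v = d) /\
  (forall S : set V, det_ic S -> forall v : V, (d <= density R S v)%E).

End Graph.

Definition cart_prod (V W : eqType) (e : rel V) (f : rel W) : rel (V * W) :=
  fun a b => (a.1 == b.1) && f a.2 b.2 || (a.2 == b.2) && e a.1 b.1.

Definition path_graph (n : nat) : rel 'I_n :=
  fun i j => ((i : nat).+1 == j) || ((j : nat).+1 == i).

Definition path_infty : rel int :=
  fun i j => (i + 1 == j) || (j + 1 == i).

(* With rows 0 and 1 of 'I_2: x_i is (i, 0) and y_i is (i, 1). *)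
Definition infinite_ladder : rel (int * 'I_2) :=
  cart_prod path_infty (@path_graph 2).

(* Main.v *)
Require Import Defs.
From mathcomp Require Import all_boot all_order all_algebra.
From mathcomp Require Import zify lra.
From mathcomp Require Import all_classical all_reals all_analysis.

(* A vertical pair at column i forces column i+1 to be nonempty, and separating a
   vertex z of column i from a vertex z' of column i+1 forces z or z' to be in
   the code. The four such pairs make one of two consecutive columns full and
   the vertical pairs make the other one nonempty, so two consecutive columns
   contain at least 3 of their 4 vertices. Omitting one vertex, always from the same
   row, in each even column attains this everywhere. A ball of radius r > 0 consists
   of 2r - 1 full columns and 2 further vertices, so its ratio of code vertices
   differs from the bound by O(1/r). *)

Set Implicit Arguments.
Unset Strict Implicit.
Unset Printing Implicit Defensive.

Import Order.TTheory GRing.Theory Num.Theory numFieldNormedType.Exports.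

Local Open Scope classical_set_scope.
Local Open Scope ring_scope.

(** * Finite cardinalities and limits superior *)

Lemma set_card_count (T : choiceType) (A : set T) (s : seq T) :
  uniq s -> A `<=` [set` s] -> set_card A = count (fun x => x \in A) s.
Proof.
(* [fset_set] sends an infinite set to the empty one, so finiteness of [A] has to come first; the
   covering list provides it. *)
move=> s_uniq As; have finA : finite_set A := sub_finite_set As (finite_seq s).
rewrite /set_card -size_filter; apply/perm_size/uniq_perm; rewrite ?filter_uniq//.
by move=> x; rewrite in_fset_set// mem_filter andb_idr// => /set_mem/As.
Qed.

Lemma limn_esup_le (R : realType) (u w : (\bar R)^nat) :
  (forall n, (u n <= w n)%E) -> (limn_esup u <= limn_esup w)%E.
Proof.
move=> uw; rewrite !limn_esup_lim.
apply: lee_lim; [exact: is_cvg_esups|exact: is_cvg_esups|].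
apply: nearW => n; apply: ub_ereal_sup => _ [k nk <-].
by apply: le_trans (uw k) _; apply: ereal_sup_ubound; exists k.
Qed.

(** * Relative coordinates and closed neighborhoods *)

Definition row (b : bool) : 'I_2 := if b then ord_max else ord0.
Arguments row : simpl never.

Lemma row_inj : injective row.
Proof. by do 2!case. Qed.

Lemma rowP (c : 'I_2) : {b : bool | c = row b}.
Proof.
exists (c == ord_max); rewrite /row; case: eqP => // nc.
by apply/val_inj; case: c nc => -[|[|//]] //= lt nc; case: nc; apply/val_inj.
Qed.

(* Vertices are addressed relative to a column i, so that statements about
   neighborhoods become computations with concrete offsets. *)
Definition vtx (i : int) (x : int * bool) : int * 'I_2 := (i + x.1, row x.2).

Lemma vtx_inj i : injective (vtx i).
Proof. by move=> [a b] [a' b'] [/addrI -> /row_inj ->]. Qed.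

Lemma vtxP i (v : int * 'I_2) : {x | v = vtx i x}.
Proof.
case: v => j c; have [b ->] := rowP c.
by exists (j - i, b); rewrite /vtx addrC subrK.
Qed.

(** The ladder is invariant under translation, so these offsets serve for every base column and
    membership in them computes. *)
Definition nb (x : int * bool) : seq (int * bool) :=
  [:: x; (x.1 - 1, x.2); (x.1 + 1, x.2); (x.1, ~~ x.2)].

Lemma nb_uniq x : uniq (nb x).
Proof.
case: x => a b; rewrite /= !inE !xpair_eqE /= !eqxx.
by case: b; rewrite /= ?andbT ?andbF ?orbF; lia.
Qed.

Lemma ladder_vtx i x y :
  infinite_ladder (vtx i x) (vtx i y) = (y != x) && (y \in nb x).
Proof.
case: x y => [a b] [a' b'].
rewrite /infinite_ladder /cart_prod /path_infty /path_graph /vtx /nb /row /= !inE.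
rewrite !xpair_eqE /=.
by case: b; case: b' => /=; rewrite -?val_eqE /=; lia.
Qed.

Lemma closed_nbhd_vtx i x y :
  (vtx i y \in closed_nbhd infinite_ladder (vtx i x)) = (y \in nb x).
Proof.
apply/idP/idP; rewrite in_setE /closed_nbhd /= ladder_vtx.
  by case=> [/vtx_inj ->|/andP[]//]; rewrite mem_head.
by move=> yx; have [->|] := eqVneq y x; [left|right].
Qed.

Lemma closed_nbhd_sub i x :
  closed_nbhd infinite_ladder (vtx i x) `<=` [set` map (vtx i) (nb x)].
Proof.
move=> v /mem_set; have [y ->] := vtxP i v; rewrite closed_nbhd_vtx => yx.
exact: map_f yx.
Qed.

Lemma in_nbhd_in S i x y :
  (vtx i y \in nbhd_in infinite_ladder S (vtx i x)) =
  (vtx i y \in S) && (y \in nb x).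
Proof. by rewrite in_setI closed_nbhd_vtx andbC. Qed.

Lemma card_nbhd_in S i x :
  set_card (nbhd_in infinite_ladder S (vtx i x)) =
  count (fun z => vtx i z \in S) (nb x).
Proof.
rewrite (@set_card_count _ _ (map (vtx i) (nb x))).
- rewrite count_map; apply: eq_in_count => z zx /=.
  by rewrite in_nbhd_in zx andbT.
- by rewrite map_inj_uniq ?nb_uniq//; exact: vtx_inj.
- by move=> v [/closed_nbhd_sub].
Qed.

Lemma card_nbhd_inD S i x y :
  set_card (nbhd_in infinite_ladder S (vtx i x)
            `\` nbhd_in infinite_ladder S (vtx i y)) =
  count (fun z => (vtx i z \in S) && (z \notin nb y)) (nb x).
Proof.
rewrite (@set_card_count _ _ (map (vtx i) (nb x))).
- rewrite count_map; apply: eq_in_count => z zx /=.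
  by rewrite in_setD !in_nbhd_in zx andbT; case: (_ \in S).
- by rewrite map_inj_uniq ?nb_uniq//; exact: vtx_inj.
- by move=> v [[/closed_nbhd_sub]].
Qed.

(** * Domination and separation in relative coordinates *)

Definition dominates (f : pred (int * bool)) x := (2 <= count f (nb x))%N.

Definition separates (f : pred (int * bool)) x y :=
  (2 <= count (fun z => f z && (z \notin nb y)) (nb x))%N
  || (2 <= count (fun z => f z && (z \notin nb x)) (nb y))%N.

(** Taking the column of the first vertex as base puts that vertex at offset 0; [f] is the code seen
    from there. *)
Lemma det_icP S :
  det_ic infinite_ladder S <->
  forall i b, let f z := vtx i z \in S in
    dominates f (0, b) /\ forall x, x != (0, b) -> separates f (0, b) x.
Proof.
split=> [[dom sep] i b f|HS].
  split=> [|x x0]; first by rewrite /dominates -card_nbhd_in.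
  have /sep : vtx i (0, b) <> vtx i x by move/vtx_inj/esym; exact/eqP.
  by rewrite !card_nbhd_inD => ?; exact/orP.
have base (v : int * 'I_2) : exists b, v = vtx v.1 (0, b).
  case: v => i c; have [b ->] := rowP c.
  by exists b; rewrite /vtx addr0.
split=> [v|u v uv].
  by have [b ->] := base v; rewrite card_nbhd_in; case: (HS v.1 b).
have [b def_u] := base u; have [x def_v] := vtxP u.1 v.
have x0 : x != (0, b) by apply/eqP => xb; apply: uv; rewrite def_v xb.
rewrite def_u def_v !card_nbhd_inD.
by apply/orP; case: (HS u.1 b) => _ /(_ x x0).
Qed.

Lemma separates_two_columns (f : pred (int * bool)) :
  (forall b b', separates f (0, b) (1, b')) ->
  separates f (0, false) (0, true) ->
  separates (fun z => f (1 + z.1, z.2)) (0, false) (0, true) ->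
  (3 <= f (0%R, false) + f (0%R, true) + (f (1%R, false) + f (1%R, true)))%N.
Proof.
move=> sep01; move: (sep01 false false) (sep01 false true) (sep01 true false).
(* The hypotheses only involve [f] on columns -1 to 2, so eight booleans decide everything. [Negz 0]
   is the offset -1. *)
by move: (sep01 true true) => {sep01}; vm_compute;
  case: (f (Posz 0, false)); case: (f (Posz 0, true));
  case: (f (Posz 1, false)); case: (f (Posz 1, true));
  case: (f (Negz 0, false)); case: (f (Negz 0, true));
  case: (f (Posz 2, false)); case: (f (Posz 2, true)).
Qed.

(** * The optimal code *)

Definition full_odd : set (int * 'I_2) :=
  [set v | (v.2 == ord_max) || odd `|v.1|%N].

(** Splitting the parity of [i + x.1] confines the dependence on [i] to one boolean, which leaves
    finitely many patterns to check. *)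
Lemma in_full_odd i x :
  (vtx i x \in full_odd) = x.2 || (odd `|i|%N (+) odd `|x.1|%N).
Proof.
rewrite /full_odd mem_setE /= unfold_in /=.
by case: x => a [] //=; rewrite /row /=; lia.
Qed.

(** Closed neighborhoods reach one column to each side, so they are disjoint at three columns apart,
    and domination alone separates. *)
Lemma separates_far (f : pred (int * bool)) b x :
  (3 <= `|x.1|)%N -> dominates f (0, b) -> separates f (0, b) x.
Proof.
case: x => a b' /= a3 dom; apply/orP; left; apply: leq_trans dom _.
apply/eq_leq/eq_in_count => z zb; rewrite andb_idr// => _.
move: zb; case: z => k c; rewrite !inE !xpair_eqE /=; lia.
Qed.

Lemma det_ic_full_odd : det_ic infinite_ladder full_odd.
Proof.
apply/det_icP => i b /=; under eq_fun do rewrite in_full_odd.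
move: (odd _) => e.
have dom : dominates (fun z => z.2 || (e (+) odd `|z.1|%N)) (0, b).
  by case: e b => -[]; vm_compute.
split=> // -[a b'] x0; have [a3|a2] := leqP 3 `|a|%N; first exact: separates_far.
(* The five nearby columns are settled by evaluation, for both parities [e]. *)
have /or4P[/eqP|/eqP|/eqP|/orP[/eqP|/eqP]] :
    [|| a == -2, a == -1, a == 0, (a == 1) | (a == 2)] by lia.
all: by move=> def_a; move: x0; rewrite def_a; case: e {dom} b b' => -[] [].
Qed.

(** * Enumeration of columns and balls *)

Fixpoint columns (i : int) (n : nat) : seq (int * 'I_2) :=
  if n is n'.+1 then [:: vtx i (0, false), vtx i (0, true) & columns (i + 1) n']
  else [::].

Lemma mem_columns i n v : (v \in columns i n) = (i <= v.1 < i + n%:Z).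
Proof.
case: v => j c /=; elim: n i => [|n IHn] i /=; first by rewrite in_nil; lia.
rewrite !inE IHn /vtx !xpair_eqE /=.
by have [b ->] := rowP c; rewrite !(inj_eq row_inj); case: b => /=; lia.
Qed.

Lemma columns_uniq i n : uniq (columns i n).
Proof.
elim: n i => //= n IHn i; rewrite inE !mem_columns IHn.
by rewrite /vtx xpair_eqE (inj_eq row_inj) /=; lia.
Qed.

Lemma size_columns i n : size (columns i n) = n.*2.
Proof. by elim: n i => //= n IHn i; rewrite IHn. Qed.

Definition column_weight (S : set (int * 'I_2)) (i : int) : nat :=
  ((vtx i (0%R, false) \in S) + (vtx i (0%R, true) \in S))%N.

(** Columns are grouped in consecutive pairs because the bound of 3 concerns such pairs. *)
Lemma count_columns S i n :
  count (fun u => u \in S) (columns i n.*2) =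
  (\sum_(k < n) (column_weight S (i + k.*2%:Z)%R +
                 column_weight S (i + k.*2%:Z + 1)%R))%N.
Proof.
elim: n i => [|n IHn] i; first by rewrite big_ord0.
rewrite big_ord_recl doubleS /= IHn addr0 /column_weight !addnA; congr (_ + _)%N.
apply: eq_bigr => k _.
by have -> : i + 1 + 1 + k.*2%:Z = i + (bump 0 k).*2%:Z by rewrite /bump; lia.
Qed.

(** A ball has an odd number of full columns; removing the last one leaves an even number to pair
    up. *)
Lemma columnsS i n :
  columns i n.+1 =
  columns i n ++ [:: vtx (i + n%:Z) (0, false); vtx (i + n%:Z) (0, true)].
Proof.
elim: n i => [|n IHn] i; first by rewrite /= addr0.
by rewrite -[LHS]/[:: _, _ & columns (i + 1) n.+1] IHn /= intS addrA.
Qed.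

Arguments columns : simpl never.

Definition sphere_ends (v : int * 'I_2) (r : nat) : seq (int * 'I_2) :=
  [:: (v.1 - r%:Z, v.2); (v.1 + r%:Z, v.2)].

(** At horizontal distance [r] only the row of [v] is reached, whence the two ends. Radius 0 is
    separate, as both ends would then be [v]. *)
Definition ball_seq (v : int * 'I_2) (r : nat) : seq (int * 'I_2) :=
  if r is r'.+1 then columns (v.1 - r'%:Z) r'.*2.+1 ++ sphere_ends v r
  else [:: v].

Definition ldist (u v : int * 'I_2) : nat :=
  (`|v.1 - u.1|%N + (v.2 != u.2))%N.

Lemma mem_ball_seq v r u : (u \in ball_seq v r) = (ldist u v <= r)%N.
Proof.
case: v u => [i c] [j d]; rewrite /ldist /= [c == d]eq_sym.
case: r => [|r]; rewrite /ball_seq.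
  by rewrite inE xpair_eqE /=; case: (d =P c) => /=; lia.
rewrite mem_cat mem_columns !inE !xpair_eqE /=.
by case: (d =P c) => /=; lia.
Qed.

Lemma ball_seq_uniq v r : uniq (ball_seq v r).
Proof.
case: v r => [i c] [|r] //; rewrite /ball_seq cat_uniq columns_uniq /= !mem_columns.
by rewrite inE xpair_eqE /=; lia.
Qed.

Lemma size_ball_seq v r : size (ball_seq v r.+1) = (4 * r.+1)%N.
Proof. by rewrite /ball_seq size_cat size_columns /=; lia. Qed.

(** * Graph distance and cardinalities of balls *)

Lemma ldist_step u v w :
  infinite_ladder u v -> (ldist u w <= (ldist v w).+1)%N.
Proof.
case: u v w => [i c] [j d] [k f].
have [[b ->] [b' ->]] := (rowP c, rowP d); have [b'' ->] := rowP f.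
rewrite /infinite_ladder /cart_prod /path_infty /path_graph /ldist /=.
by rewrite !(inj_eq row_inj) /row; case: b; case: b'; case: b'' => /=; lia.
Qed.

Lemma ldist_le_walk p u :
  path infinite_ladder u p -> (ldist u (last u p) <= size p)%N.
Proof.
elim: p u => [|v p IHp] u /=; first by rewrite /ldist subrr eqxx.
by case/andP=> uv /IHp vp; apply: leq_trans (ldist_step _ uv) _.
Qed.

(** Induction on [ldist]: a vertex different from [v] has a neighbor one step closer. With
    [ldist_le_walk], this makes [ldist] the graph distance. *)
Lemma has_walk_ldist u v : has_walk infinite_ladder u v (ldist u v).
Proof.
have [n] : {n | ldist u v = n} by exists (ldist u v).
elim: n u => [|n IHn] u duv; rewrite duv.
  exists [::]; split=> //=; case: u v duv => [i c] [j d]; rewrite /ldist /=.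
  by case: (d =P c) => [->|_] /= ij; [congr pair; lia|lia].
suff [w uw dwv] : exists2 w, infinite_ladder u w & ldist w v = n.
  have := IHn w dwv; rewrite dwv => -[p [wp lp sp]].
  by exists (w :: p); rewrite /= uw wp sp.
case: u v duv {IHn} => [i c] [j d]; have [b ->] := rowP c; have [b' ->] := rowP d.
rewrite /infinite_ladder /cart_prod /path_infty /path_graph /ldist /=.
rewrite (inj_eq row_inj).
(* The walk changes row first if needed, then moves horizontally towards [v]. *)
have [-> dij|ne dij] := eqVneq b' b; last first.
  exists (i, row b') => /=; last by rewrite eqxx; lia.
  by rewrite eqxx; case: b b' ne {dij} => -[].
have [ij|ji] := ltrP i j.
  by exists (i + 1, row b) => /=; rewrite ?eqxx; lia.
by exists (i - 1, row b) => /=; rewrite ?eqxx; lia.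
Qed.

Lemma gball_ladder v r :
  gball infinite_ladder v r = [set u | (ldist u v <= r)%N].
Proof.
have dist_le w m : has_walk infinite_ladder w v m -> (ldist w v <= m)%N.
  by case=> p [/ldist_le_walk + <- <-].
apply/seteqP; split=> [u [n [walk _] nr]|u vu] /=.
  exact: leq_trans (dist_le _ _ walk) nr.
by exists (ldist u v) => //; split; [exact: has_walk_ldist|exact: (dist_le u)].
Qed.

Lemma card_gball v r :
  set_card (gball infinite_ladder v r) = size (ball_seq v r).
Proof.
rewrite gball_ladder (set_card_count (ball_seq_uniq v r)) => [|u /=].
  apply/eqP; rewrite -all_count; apply/allP => u.
  by rewrite mem_ball_seq => vu; rewrite inE.
by rewrite mem_ball_seq.
Qed.

Lemma card_gballI v r S :
  set_card (gball infinite_ladder v r `&` S) =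
  count (fun u => u \in S) (ball_seq v r).
Proof.
rewrite gball_ladder (set_card_count (ball_seq_uniq v r)) => [|u []].
  apply: eq_in_count => u; rewrite mem_ball_seq => vu.
  by rewrite in_setI andb_idl// => _; rewrite inE.
by rewrite /= mem_ball_seq.
Qed.

(** * Code vertices in a ball *)

Lemma det_ic_column_weight S i : det_ic infinite_ladder S ->
  (3 <= column_weight S i + column_weight S (i + 1)%R)%N.
Proof.
move/det_icP => HS; have shift1 z : vtx (i + 1) z = vtx i (1 + z.1, z.2).
  by rewrite /vtx addrA.
rewrite /column_weight !shift1.
apply: (@separates_two_columns (fun z => vtx i z \in S)) => [b b'||].
- by case: (HS i b) => _; apply.
- by case: (HS i false) => _; apply.
(* The vertical pair of column [i + 1] is separated with that column as base, then rewritten in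
   offsets from [i]. *)
have [_ /(_ (0, true) isT)] := HS (i + 1) false.
by under eq_fun do rewrite shift1.
Qed.

Lemma column_weight_full_odd i :
  (column_weight full_odd i + column_weight full_odd (i + 1)%R)%N = 3%N.
Proof. by rewrite /column_weight !in_full_odd /=; lia. Qed.

(** Apart from [r] pairs of columns, the ball of radius [r.+1] has four vertices: the last full
    column and the two ends. *)
Lemma count_ball_seq S v r m :
  m = (\sum_(k < r) (column_weight S (v.1 - r%:Z + k.*2%:Z)%R +
                     column_weight S (v.1 - r%:Z + k.*2%:Z + 1)%R))%N ->
  (m <= count (fun u => u \in S) (ball_seq v r.+1) <= m + 4)%N.
Proof.
move=> ->; rewrite /ball_seq columnsS !count_cat count_columns /=.
move: (\sum_(k < r) _)%N => {}m.
by do 4!case: (_ \in S) => /=; lia.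
Qed.

(** For radius [r.+1], at least [3 * r] of [4 * r.+1] vertices are in the code; the slack 12 is 3
    times the four unpaired vertices. *)
Lemma det_ic_count S v r : det_ic infinite_ladder S ->
  (3 * size (ball_seq v r) <= 4 * count (fun u => u \in S) (ball_seq v r) + 12)%N.
Proof.
move=> HS; case: r => [|r]; first by rewrite /=; lia.
rewrite size_ball_seq.
suff : (r * 3 <= count (fun u => u \in S) (ball_seq v r.+1))%N by lia.
have /andP[le_count _] := @count_ball_seq S v r _ erefl.
apply: leq_trans le_count; rewrite -{1}[r]card_ord -sum_nat_const.
by apply: leq_sum => k _; exact: det_ic_column_weight.
Qed.

Lemma count_full_odd v r :
  (4 * count (fun u => u \in full_odd) (ball_seq v r) <=
   3 * size (ball_seq v r) + 12)%N.
Proof.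
case: r => [|r]; first by rewrite /=; lia.
rewrite size_ball_seq; have /andP[_] := @count_ball_seq full_odd v r _ erefl.
rewrite (eq_bigr (fun=> 3%N)) => [|k _]; last exact: column_weight_full_odd.
by rewrite sum_nat_const card_ord; lia.
Qed.

(** * Density bounds *)

Section Density.
Variable R : realType.

Definition ball_ratio (S : set (int * 'I_2)) v r : R :=
  (set_card (gball infinite_ladder v r `&` S))%:R /
  (set_card (gball infinite_ladder v r))%:R.

Lemma harmonic_ball_size_ge1 v r : 1 <= harmonic r * (size (ball_seq v r))%:R :> R.
Proof.
rewrite /harmonic /= mulrC ler_pdivlMr ?ltr0n// mul1r ler_nat.
by case: r => // r; rewrite size_ball_seq; lia.
Qed.

Lemma size_ball_seq_gt0 v r : 0 < (size (ball_seq v r))%:R :> R.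
Proof. by case: r => // r; rewrite size_ball_seq ltr0n; lia. Qed.

(** Dividing [det_ic_count] by 4 times the ball size turns the slack 12 into 3 over that size, which
    is at most [3 * harmonic r]. *)
Lemma ball_ratio_ge S v r : det_ic infinite_ladder S ->
  3%:R / 4%:R - 3%:R * harmonic r <= ball_ratio S v r.
Proof.
move=> /(det_ic_count v r); rewrite -(ler_nat R) natrD !natrM.
rewrite /ball_ratio card_gball card_gballI ler_pdivlMr ?size_ball_seq_gt0//.
rewrite mulrBl -[_ * harmonic r * _]mulrA.
have := harmonic_ball_size_ge1 v r; move: (harmonic r * _) => h; lra.
Qed.

Lemma ball_ratio_full_odd_le v r :
  ball_ratio full_odd v r <= 3%:R / 4%:R + 3%:R * harmonic r.
Proof.
have := count_full_odd v r; rewrite -(ler_nat R) natrD !natrM.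
rewrite /ball_ratio card_gball card_gballI ler_pdivrMr ?size_ball_seq_gt0//.
rewrite [(_ / _ + _) * _]mulrDl -[_ * harmonic r * _]mulrA.
have := harmonic_ball_size_ge1 v r; move: (harmonic r * _) => h; lra.
Qed.

Lemma cvg_34_harmonic (c : R) :
  (fun r => 3%:R / 4%:R + c * harmonic r) @ \oo --> (3%:R / 4%:R : R).
Proof.
have : (fun r => 3%:R / 4%:R + c * harmonic r) @ \oo -->
    (3%:R / 4%:R + c * 0 : R).
  apply: cvgD; first exact: cvg_cst.
  by apply: cvgM; [exact: cvg_cst|exact: cvg_harmonic].
by rewrite mulr0 addr0.
Qed.

(** The ratios are squeezed between two sequences tending to 3/4, so they converge and their limit
    superior is the limit. *)
Lemma density_full_odd v :
  density infinite_ladder R full_odd v = (3%:R / 4%:R)%:E.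
Proof.
apply: (cvg_limn_einf_sup _).2; apply: cvg_EFin; first exact: nearW.
apply: (squeeze_cvgr _ (cvg_34_harmonic (- 3%:R)) (cvg_34_harmonic 3%:R)).
apply: nearW => r; rewrite ball_ratio_full_odd_le andbT mulNr.
exact/ball_ratio_ge/det_ic_full_odd.
Qed.

(** The ratios of an arbitrary code may fail to converge, so limits superior are compared with those
    of a convergent minorant. *)
Lemma density_ge S v : det_ic infinite_ladder S ->
  ((3%:R / 4%:R)%:E <= density infinite_ladder R S v)%E.
Proof.
move=> HS; pose u r : \bar R := (3%:R / 4%:R + - 3%:R * harmonic r)%:E.
have lim_u : u @ \oo --> (3%:R / 4%:R)%:E.
  by apply: cvg_EFin; [exact: nearW|exact: cvg_34_harmonic].
rewrite -(cvg_limn_einf_sup lim_u).2; apply: limn_esup_le => r.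
by rewrite lee_fin mulNr; exact: ball_ratio_ge.
Qed.

End Density.

Theorem theorem4p1 (R : realType) :
  @det_ic_pct (int * 'I_2)%type infinite_ladder R ((3%:R / 4%:R : R)%:E)%R.
Proof.
split; last by move=> S HS v; exact: density_ge.
by exists full_odd; [exact: det_ic_full_odd|exact: density_full_odd].
Qed.
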